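(* Let $n,r\ge 1$ be integers with $n\ge r$, and let $k_{1},\dots,k_{r}$ be integers. Then $$L^{(k_{1},k_{2},\dots,k_{r})}(n,r)= \sum_{l=r}^{n}\sum_{m=r}^{l}S_{1}^{(k_{1},\dots,k_{r})}(m,r)\,(-1)^{m-l}\,S_{2}(l,m)\binom{r+n-l-1}{n-l}\frac{n!}{l!}.$$
   Context: For arbitrary integers $k_1,\dots,k_r$ ($r\ge 1$), the multiple logarithm is $\mathrm{Li}_{k_{1},\dots,k_{r}}(z)=\sum_{0<m_{1}<m_{2}<\cdots<m_{r}}\frac{z^{m_{r}}}{m_{1}^{k_{1}}m_{2}^{k_{2}}\cdots m_{r}^{k_{r}}}$ for $|z|<1$ (the sum is over positive integers; it may equally be regarded as a formal power series in $z$). The multi-Stirling numbers of the first kind $S_{1}^{(k_{1},\dots,k_{r})}(n,r)$ are defined by $\mathrm{Li}_{k_{1},\dots,k_{r}}(t)=\sum_{n=r}^{\infty}S_{1}^{(k_{1},\dots,k_{r})}(n,r)\frac{t^{n}}{n!}$. The multi-Lah numbers $L^{(k_{1},\dots,k_{r})}(n,r)$ are defined, for arbitrary integers $k_1,\dots,k_r$, by $\frac{\mathrm{Li}_{k_{1},\dots,k_{r}}(1-e^{-t})}{(1-t)^{r}}=\sum_{n=r}^{\infty} L^{(k_{1},\dots,k_{r})}(n,r)\frac{t^{n}}{n!}$. The Stirling numbers of the second kind $S_2(n,k)$ are defined by $\frac{1}{k!}(e^{t}-1)^{k}=\sum_{n=k}^{\infty}S_{2}(n,k)\frac{t^{n}}{n!}$.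 *)

(* Defs.v *)
From mathcomp Require Import all_boot all_order all_algebra.

Set Implicit Arguments.
Unset Strict Implicit.
Unset Printing Implicit Defensive.

Import Order.TTheory GRing.Theory Num.Theory.
Local Open Scope ring_scope.

(* Formal power series over the rationals: [a n] is the coefficient of t^n.
   All the generating functions below have rational coefficients. *)
Definition fps := nat -> rat.

Definition fps_one : fps := fun n => (n == 0%N)%:R.

Definition fps_var : fps := fun n => (n == 1%N)%:R.

Definition fps_sub (a b : fps) : fps := fun n => a n - b n.

Definition fps_scale (c : rat) (a : fps) : fps := fun n => c * a n.

Definition fps_mul (a b : fps) : fps :=
  fun n => \sum_(i < n.+1) a i * b (n - i)%N.

Definition fps_pow (a : fps) (m : nat) : fps := iter m (fps_mul a) fps_one.

(* The first n + 1 coefficients of 1 / a, from the recurrence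
   a_0 b_0 = 1 and a_0 b_n = - \sum_(1 <= i <= n) a_i b_(n-i).
   Meaningful only if a_0 != 0; see fps_mulV. *)
Fixpoint fps_inv_seq (a : fps) (n : nat) : seq rat :=
  if n is n'.+1 then
    let s := fps_inv_seq a n' in
    rcons s (- (a 0%N)^-1 * \sum_(i < n'.+1) a i.+1 * s`_(n' - i))
  else [:: (a 0%N)^-1].

Definition fps_inv (a : fps) : fps := fun n => (fps_inv_seq a n)`_n.

Definition fps_div (a b : fps) : fps := fps_mul a (fps_inv b).

(* a(b(t)), meaningful only if b_0 = 0: then t^i divides b^i, so that the
   powers b^i with i > n do not contribute to the coefficient of t^n. *)
Definition fps_comp (a b : fps) : fps :=
  fun n => \sum_(i < n.+1) a i * fps_pow b i n.

(* e^(c t) *)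
Definition fps_exp (c : rat) : fps := fun n => c ^+ n / n`!%:R.

Lemma size_fps_inv_seq (a : fps) (n : nat) : size (fps_inv_seq a n) = n.+1.
Proof. by elim: n => //= n IHn; rewrite size_rcons IHn. Qed.

Lemma nth_fps_inv_seq (a : fps) (n j : nat) :
  (j <= n)%N -> (fps_inv_seq a n)`_j = fps_inv a j.
Proof.
elim: n => [|n IHn]; first by rewrite leqn0 => /eqP->.
rewrite leq_eqVlt => /predU1P[->//|lt_jn].
by rewrite /= nth_rcons size_fps_inv_seq lt_jn IHn.
Qed.

Lemma fps_mulV (a : fps) :
  a 0%N != 0 -> fps_mul a (fps_inv a) =1 fps_one.
Proof.
move=> a0 [|n]; first by rewrite /fps_mul big_ord1 /fps_inv /= mulfV.
rewrite /fps_mul big_ord_recl subn0 {1}/fps_inv /= nth_rcons.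
rewrite size_fps_inv_seq ltnn eqxx mulrA mulrN mulfV // mulN1r.
apply/eqP; rewrite addrC subr_eq0; apply/eqP/eq_bigr => i _.
by rewrite nth_fps_inv_seq ?leq_subr // /bump leq0n add1n subSS.
Qed.

(* The coefficient of z^n in Li_(k_1, ..., k_r)(z) collects the indices
   0 < m_1 < ... < m_r with m_r = n, so that every m_i is at most n. *)
Definition multilog (r : nat) (k : r.-tuple int) : fps := fun n =>
  \sum_(m : r.-tuple 'I_n.+1 |
          path ltn 0 (map val m) && (last 0%N (map val m) == n))
    (\prod_(i < r) ((tnth m i)%:R : rat) ^ tnth k i)^-1.

(* S_1^(k_1, ..., k_r)(n, r), where r is the length of k *)
Definition multiStirling1 (r : nat) (k : r.-tuple int) (n : nat) : rat :=
  n`!%:R * multilog k n.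

(* L^(k_1, ..., k_r)(n, r), where r is the length of k *)
Definition multiLah (r : nat) (k : r.-tuple int) (n : nat) : rat :=
  n`!%:R *
  fps_div (fps_comp (multilog k) (fps_sub fps_one (fps_exp (-1))))
          (fps_pow (fps_sub fps_one fps_var) r) n.

Definition Stirling2 (n m : nat) : rat :=
  n`!%:R * fps_scale (m`!%:R)^-1 (fps_pow (fps_sub (fps_exp 1) fps_one) m) n.

(* Main.v *)
Require Import Defs.
From mathcomp Require Import all_boot all_order all_algebra.
From mathcomp Require Import zify ring.

(** Read off the coefficient of [t^n] in [Li(1 - e^(-t)) * (1 - t)^(-r)].
    The Cauchy product runs over [l], the order contributed by the composite,
    and the composite itself runs over the power [m] of [1 - e^(-t)].  Two
    expansions then give the summand:
    - [1 - e^(-t)] arises from [e^t - 1] by changing [t] to [-t] and the overall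
      sign, so the coefficient of [t^l] in its [m]-th power is [(-1)^(m + l)]
      times that of [(e^t - 1)^m], which is [m! S_2(l, m) / l!]
      ([fps_pow_reflect]);
    - the coefficient of [t^j] in [(1 - t)^(-r)] is [C(r + j - 1, j)]
      ([fps_inv_pow_1subX]): by Pascal's rule each factor [1 - t] lowers [r]
      by one in these series, down to the series [1] at [r = 0], and an inverse
      is determined by its product with the invertible series
      ([fps_inv_unique]).
    The sums may start at [r] because [Li_(k_1, ..., k_r)] has order at least
    [r]: a chain [0 < m_1 < ... < m_r = n] forces [r <= n]
    ([multilog_lt]). *)

Import Order.TTheory GRing.Theory Num.Theory.
Local Open Scope ring_scope.

(** * The ring of formal power series *)

Lemma eq_fps_mul (a a' b b' : fps) :
  a =1 a' -> b =1 b' -> fps_mul a b =1 fps_mul a' b'.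
Proof. by move=> eqa eqb n; apply: eq_bigr => i _; rewrite eqa eqb. Qed.

(** Coefficients of low order only see truncations, so that ring identities
    for power series can be inherited from [{poly rat}]. *)
Lemma fps_mul_trunc (a b : fps) (N n : nat) : (n < N)%N ->
  fps_mul a b n = ((\poly_(i < N) a i) * (\poly_(i < N) b i))`_n.
Proof.
move=> lt_nN; rewrite coefM; apply: eq_bigr => i _; rewrite !coef_poly.
have lt_iN : (i < N)%N by apply: leq_trans (ltn_ord i) lt_nN.
by rewrite lt_iN (leq_ltn_trans (leq_subr i n) lt_nN).
Qed.

Lemma fps_mulC (a b : fps) : fps_mul a b =1 fps_mul b a.
Proof. by move=> n; rewrite !(@fps_mul_trunc _ _ n.+1) // mulrC. Qed.

Lemma fps_mulA (a b c : fps) :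
  fps_mul a (fps_mul b c) =1 fps_mul (fps_mul a b) c.
Proof.
move=> n; pose T (f : fps) := \poly_(i < n.+1) f i.
have TE (f : fps) i : (i <= n)%N -> (T f)`_i = f i.
  by move=> le_in; rewrite coef_poly ltnS le_in.
transitivity ((T a * (T b * T c))`_n).
  rewrite coefM; apply: eq_bigr => i _.
  by rewrite TE -1?ltnS // (@fps_mul_trunc _ _ n.+1) // ltnS leq_subr.
rewrite mulrA coefM; apply: eq_bigr => i _.
by rewrite (TE c) ?leq_subr // (@fps_mul_trunc _ _ n.+1).
Qed.

Lemma fps_mul1 (a : fps) : fps_mul fps_one a =1 a.
Proof.
move=> n; rewrite /fps_mul big_ord_recl subn0 big1 => [|i _].
  by rewrite addr0 /fps_one mul1r.
by rewrite /fps_one mul0r.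
Qed.

Lemma fps_inv_unique (a b : fps) :
  a 0%N != 0 -> fps_mul a b =1 fps_one -> fps_inv a =1 b.
Proof.
move=> a0 ab1 n; rewrite -[LHS]fps_mul1.
rewrite -(eq_fps_mul _ _ _ _ ab1 (frefl (fps_inv a))) fps_mulC fps_mulA.
have aV : fps_mul (fps_inv a) a =1 fps_one.
  by move=> i; rewrite fps_mulC fps_mulV.
by rewrite (eq_fps_mul _ _ _ _ aV (frefl b)) fps_mul1.
Qed.

(** * The inverse powers of 1 - t *)

Lemma fps_mul_1subX (a : fps) (n : nat) :
  fps_mul (fps_sub fps_one fps_var) a n =
  if n is n'.+1 then a n'.+1 - a n' else a 0%N.
Proof.
rewrite /fps_mul /fps_sub /fps_one /fps_var; case: n => [|n].
  by rewrite big_ord1 subr0 mul1r.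
rewrite !big_ord_recl big1 => [|i _]; last by rewrite subr0 mul0r.
by rewrite /= subr0 mul1r sub0r mulN1r addr0 subn1.
Qed.

(** Truncated subtraction makes this the series [1] at [r = 0], which starts
    the induction of [fps_pow_1subX_mul]. *)
Definition neg_binomial_series (r : nat) : fps :=
  fun j => 'C(r + j - 1, j)%:R.

Lemma fps_pow_1subX_mul (r : nat) :
  fps_mul (fps_pow (fps_sub fps_one fps_var) r) (neg_binomial_series r)
  =1 fps_one.
Proof.
elim: r => [|r IHr] n.
  rewrite fps_mul1 /neg_binomial_series /fps_one add0n.
  by case: n => [|n]; rewrite ?bin0 // subn1 bin_small.
have pascal : fps_mul (fps_sub fps_one fps_var) (neg_binomial_series r.+1)
              =1 neg_binomial_series r.
  move=> [|j]; rewrite fps_mul_1subX /neg_binomial_series ?bin0 //.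
  have -> : (r.+1 + j.+1 - 1 = (r + j).+1)%N by lia.
  have -> : (r.+1 + j - 1 = r + j)%N by lia.
  have -> : (r + j.+1 - 1 = r + j)%N by lia.
  by rewrite binS natrD addrK.
rewrite -IHr -[RHS](eq_fps_mul _ _ _ _ (frefl _) pascal) fps_mulA.
by apply: eq_fps_mul => // i; rewrite fps_mulC.
Qed.

Lemma fps_pow_coef0 (a : fps) (m : nat) : fps_pow a m 0%N = a 0%N ^+ m.
Proof.
by elim: m => [|m IHm] //; rewrite exprS -IHm; exact: big_ord1.
Qed.

Lemma fps_inv_pow_1subX (r : nat) :
  fps_inv (fps_pow (fps_sub fps_one fps_var) r) =1 neg_binomial_series r.
Proof.
apply: fps_inv_unique (fps_pow_1subX_mul r).
by rewrite fps_pow_coef0 /fps_sub /fps_one /fps_var subr0 expr1n oner_eq0.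
Qed.

(** * The powers of 1 - e^(-t) *)

(** The hypothesis says [b(t) = - a(-t)], so that [b^m] is
    [(-1)^m a^m (-t)]. *)
Lemma fps_pow_reflect (a b : fps) (m n : nat) :
  (forall i, b i = (-1) ^+ i.+1 * a i) ->
  fps_pow b m n = (-1) ^+ (m + n) * fps_pow a m n.
Proof.
move=> bE; elim: m n => [|m IHm] n.
  by case: n => [|n]; rewrite ?mul1r // mulr0.
rewrite /fps_pow !iterS -/(fps_pow a m) -/(fps_pow b m).
rewrite /fps_mul big_distrr /=; apply: eq_bigr => i _.
have -> : (m.+1 + n = i.+1 + (m + (n - i)))%N by have := ltn_ord i; lia.
by rewrite bE IHm (exprD _ i.+1); ring.
Qed.

Lemma fps_1_sub_expN (i : nat) :
  fps_sub fps_one (fps_exp (-1)) i =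
  (-1) ^+ i.+1 * fps_sub (fps_exp 1) fps_one i.
Proof.
rewrite /fps_sub /fps_exp /fps_one expr1n; case: i => [|i] /=.
  by rewrite divr1 !subrr mulr0.
by rewrite sub0r subr0 (exprS _ i.+1) mulN1r mulNr div1r.
Qed.

(** * Assembling the formula *)

Lemma path_ltn_size (x : nat) (s : seq nat) :
  path ltn x s -> (x + size s <= last x s)%N.
Proof.
elim: s x => [|y s IHs] x /=; first by rewrite addn0.
by case/andP=> lt_xy /IHs; lia.
Qed.

Lemma multilog_lt (r : nat) (k : r.-tuple int) (n : nat) :
  (n < r)%N -> multilog k n = 0.
Proof.
move=> lt_nr; rewrite /multilog big_pred0 // => m.
apply/negP => /andP[/path_ltn_size le_r /eqP last_n].
by move: le_r; rewrite last_n add0n size_map size_tuple leqNgt lt_nr.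
Qed.

Lemma sum_ord_low0 (F : nat -> rat) (r n : nat) :
    (forall i, (i < r)%N -> F i = 0) ->
  \sum_(i < n.+1) F i = \sum_(r <= i < n.+1) F i.
Proof.
move=> F0; rewrite -(big_mkord xpredT F).
case: (leqP r n.+1) => [le_rn|lt_nr].
  rewrite (big_cat_nat (leq0n r) le_rn) /=.
  by rewrite [X in X + _ = _]big_nat big1 ?add0r // => i /andP[_ /F0].
rewrite [RHS]big_geq 1?ltnW // big_nat big1 // => i /andP[_ lt_in].
by apply: F0; apply: ltn_trans lt_in lt_nr.
Qed.

Lemma expN1_subz (m l : nat) : (-1 : rat) ^ (m%:Z - l%:Z) = (-1) ^+ (m + l).
Proof. by rewrite expfzDr // -exprz_inv invrN1 exprD. Qed.

Lemma multilog_comp_coef (r : nat) (k : r.-tuple int) (l : nat) :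
  fps_comp (multilog k) (fps_sub fps_one (fps_exp (-1))) l =
  \sum_(r <= m < l.+1)
    multiStirling1 k m * (-1) ^ (m%:Z - l%:Z) * Stirling2 l m / l`!%:R.
Proof.
have fact_neq0 j : (j`!%:R : rat) != 0 by rewrite pnatr_eq0 -lt0n fact_gt0.
rewrite /fps_comp.
rewrite (sum_ord_low0 (fun m => multilog k m * fps_pow _ m l) r) => [|m lt_mr].
  apply: eq_bigr => m _.
  rewrite (fps_pow_reflect _ _ m l fps_1_sub_expN) expN1_subz.
  rewrite /multiStirling1 /Stirling2 /fps_scale.
  by field; rewrite !fact_neq0.
by rewrite multilog_lt // mul0r.
Qed.

Theorem theorem5 (n r : nat) (k : r.-tuple int)
    (hn : (1 <= n)%N) (hr : (1 <= r)%N) (hrn : (r <= n)%N) :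
  multiLah k n =
  \sum_(r <= l < n.+1) \sum_(r <= m < l.+1)
    multiStirling1 k m * (-1) ^ (m%:Z - l%:Z) * Stirling2 l m *
    'C(r + n - l - 1, n - l)%:R * (n`!%:R / l`!%:R).
Proof.
rewrite /multiLah /fps_div /fps_mul.
rewrite (sum_ord_low0 (fun l => fps_comp _ _ l * fps_inv _ (n - l)%N) r).
  rewrite big_distrr /= !big_nat; apply: eq_bigr => l /andP[_ lt_ln].
  rewrite multilog_comp_coef fps_inv_pow_1subX /neg_binomial_series.
  rewrite addnBA -1?ltnS // big_distrl big_distrr /=.
  by apply: eq_bigr => m _; ring.
by move=> l lt_lr; rewrite multilog_comp_coef big_geq ?mul0r.
Qed.
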